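(* Let $r\ge1$ and let $b_1\ge\cdots\ge b_r$ be integers with $b_i\ge i$ for all $i$. Let $\widehat F_{\mathbf b}=F_{\mathbf b}\sqcup\{\widehat0\}$ be the Ferrers-cell poset with a new minimum $\widehat0$ adjoined, with rank $\widehat\rho(\widehat0)=0$ and $\widehat\rho(i,c)=c-i+1$, and let $$X_{\widehat F_{\mathbf b}}(y)=\sum_{x\in\widehat F_{\mathbf b}}\mu(\widehat0,x)\,y^{\,b_1-\widehat\rho(x)}$$ be its characteristic polynomial, where $\mu$ is the Möbius function of $\widehat F_{\mathbf b}$. Then $$X_{\widehat F_{\mathbf b}}(y)=y^{b_1}-r\,y^{b_1-1}+(r-1)\,y^{b_1-2},$$ where the last term is understood to be absent when $r=1$. Thus the characteristic polynomial is independent of $b_2,\dots,b_r$. In particular, for the balanced boundary $b_i=2r-i$ and $r\ge2$, writing $\widehat C_r$ for the corresponding lattice $\widehat F_{\mathbf b}$ (the minimum-augmented positive-root poset of type $B_r$, equivalently of type $C_r$), $$X_{\widehat C_r}(y)=y^{2r-3}(y-1)\bigl(y-(r-1)\bigr).$$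
   Context: Ferrers-cell poset: $F_{\mathbf b}=\{(i,c):1\le i\le r,\ i\le c\le b_i\}$, ordered by $(i,c)\le(j,d)\iff i\ge j$ and $c\le d$. In $\widehat F_{\mathbf b}$ the element $\widehat0$ lies below every cell. *)

(* Defs.v *)
From HB Require Import structures.
From mathcomp Require Import all_boot all_order all_algebra.

Set Implicit Arguments.
Unset Strict Implicit.
Unset Printing Implicit Defensive.

Import Order.TTheory GRing.Theory Num.Theory.

Local Open Scope order_scope.
Local Open Scope ring_scope.

(** * Moebius function of a finite poset *)

Section Moebius.
Context {d : Order.disp_t} {T : finPOrderType d}.

(* The first argument is fuel: #|T| is enough, see [moebiusE]. *)
Fixpoint moebius_rec (n : nat) (x y : T) : int :=
  if x == y then 1
  else if n is m.+1 then
    if (x < y)%O then - \sum_(z : T | (x <= z < y)%O) moebius_rec m x z else 0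
  else 0.

Definition moebius (x y : T) : int := moebius_rec #|T| x y.

Lemma moebius_rec_fuel (n m : nat) (x y : T) :
  (#|[pred z : T | (z < y)%O]| <= n)%N -> (#|[pred z : T | (z < y)%O]| <= m)%N ->
  moebius_rec n x y = moebius_rec m x y.
Proof.
elim: n m y => [|n IH] [|m] y //=; case: (eqVneq x y) => // _.
- move=> + _; rewrite leqn0 => /eqP/card0_eq/(_ x); rewrite inE => -> //.
- move=> _; rewrite leqn0 => /eqP/card0_eq/(_ x); rewrite inE => -> //.
move=> hn hm; case: ifP => // _; congr (- _).
apply: eq_bigr => z /andP[_ zy].
have lt_card : (#|[pred t : T | (t < z)%O]| < #|[pred t : T | (t < y)%O]|)%N.
  apply/proper_card/properP; split.
    by apply/subsetP => t; rewrite !inE => /lt_trans; apply.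
  by exists z; rewrite !inE // ltxx.
by apply: IH; rewrite -ltnS; apply: leq_trans lt_card _.
Qed.

Lemma moebiusE (x y : T) :
  moebius x y =
  if x == y then 1
  else if (x < y)%O then - \sum_(z : T | (x <= z < y)%O) moebius x z else 0.
Proof.
have le_card (z : T) : (#|[pred t : T | (t < z)%O]| <= #|T|)%N by exact: max_card.
rewrite {1}/moebius (@moebius_rec_fuel _ #|T|.+1) //=; last exact: leqW.
Qed.

End Moebius.

(** * Adjoining a new minimum to a poset *)

Definition with_bot (T : Type) : Type := option T.

HB.instance Definition _ (T : finType) := Finite.copy (with_bot T) (option T).

Section WithBot.
Context {d : Order.disp_t} {T : finPOrderType d}.

Definition with_bot_le (x y : with_bot T) : bool :=
  match x, y with
  | None, _ => true
  | Some _, None => false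
  | Some a, Some b => (a <= b)%O
  end.

Fact with_bot_le_refl : reflexive with_bot_le.
Proof. by case=> //= a. Qed.

Fact with_bot_le_anti : antisymmetric with_bot_le.
Proof. by case=> [a|] [b|] //= /le_anti ->. Qed.

Fact with_bot_le_trans : transitive with_bot_le.
Proof. by case=> [a|] [b|] [c|] //=; apply: le_trans. Qed.

HB.instance Definition _ := Order.Le_isPOrder.Build d (with_bot T)
  with_bot_le_refl with_bot_le_anti with_bot_le_trans.

Fact with_bot_le0x (x : with_bot T) : ((None : with_bot T) <= x)%O.
Proof. by []. Qed.

HB.instance Definition _ := Order.hasBottom.Build d (with_bot T) with_bot_le0x.

End WithBot.

Definition is_lattice (d : Order.disp_t) (T : porderType d) : Prop :=
  forall x y : T,
    (exists m : T, forall z : T, (z <= m)%O = (z <= x)%O && (z <= y)%O) /\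
    (exists j : T, forall z : T, (j <= z)%O = (x <= z)%O && (y <= z)%O).

(** * Ferrers-cell posets *)

(* A boundary b_1 >= ... >= b_r is a function [b : nat -> nat] of which only the
   values at 1, ..., r matter. *)
Definition boundary (r : nat) (b : nat -> nat) : Prop :=
  (forall i j : nat, (1 <= i)%N -> (i <= j)%N -> (j <= r)%N -> (b j <= b i)%N) /\
  (forall i : nat, (1 <= i)%N -> (i <= r)%N -> (i <= b i)%N).

Definition in_ferrers (r : nat) (b : nat -> nat) (x : nat * nat) : bool :=
  [&& (1 <= x.1 <= r)%N & (x.1 <= x.2 <= b x.1)%N].

Record ferrers (r : nat) (b : nat -> nat) : Type := FerrersCell {
  cell :> nat * nat;
  cellP : in_ferrers r b cell
}.

Fact ferrers_display : Order.disp_t. Proof. exact: Order.Disp tt tt. Qed.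

Section FerrersPoset.
Variables (r : nat) (b : nat -> nat).

HB.instance Definition _ := [isSub for @cell r b].
HB.instance Definition _ := [Countable of ferrers r b by <:].

Definition ferrers_enum : seq (ferrers r b) :=
  pmap insub [seq (i, c) | i <- iota 1 r, c <- iota i ((b i).+1 - i)].

Fact ferrers_enumP : Finite.axiom ferrers_enum.
Proof.
move=> x; rewrite count_uniq_mem; last first.
  apply/pmap_sub_uniq/allpairs_uniq_dep; first exact: iota_uniq.
    by move=> i _; apply: iota_uniq.
  by move=> [i c] [j e] _ _ /= [-> ->].
case: x => -[i c] xP; rewrite mem_pmap_sub /=.
have /andP[/andP[/= i1 ir] /andP[/= ic cb]] := xP.
suff -> : (i, c) \in [seq (i, c) | i <- iota 1 r, c <- iota i ((b i).+1 - i)] by [].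
apply/allpairsPdep; exists i, c; split=> //.
  by rewrite mem_iota i1 add1n ltnS.
by rewrite mem_iota ic subnKC ?ltnS // (leq_trans ic) // leqW.
Qed.

HB.instance Definition _ := isFinite.Build (ferrers r b) ferrers_enumP.

(* The row order is reversed. *)
Definition ferrers_le (x y : ferrers r b) : bool :=
  (y.1 <= x.1)%N && (x.2 <= y.2)%N.

Fact ferrers_le_refl : reflexive ferrers_le.
Proof. by move=> x; rewrite /ferrers_le !leqnn. Qed.

Fact ferrers_le_anti : antisymmetric ferrers_le.
Proof.
move=> x y /andP[/andP[h1 h2] /andP[h3 h4]]; apply: val_inj => /=.
by case: x y h1 h2 h3 h4 => -[i c] ? [[j e] ?] /= h1 h2 h3 h4;
   congr (_, _); apply: anti_leq; rewrite ?h1 ?h2 ?h3 ?h4.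
Qed.

Fact ferrers_le_trans : transitive ferrers_le.
Proof.
move=> y x z /andP[h1 h2] /andP[h3 h4]; apply/andP; split.
  exact: leq_trans h3 h1.
exact: leq_trans h2 h4.
Qed.

HB.instance Definition _ := Order.Le_isPOrder.Build ferrers_display (ferrers r b)
  ferrers_le_refl ferrers_le_anti ferrers_le_trans.

End FerrersPoset.

Notation ferrers_hat r b := (with_bot (ferrers r b)).

Definition rank_hat (r : nat) (b : nat -> nat) (x : ferrers_hat r b) : nat :=
  if x is Some u then (u.2 - u.1 + 1)%N else 0%N.

(* Under [boundary r b] one has rank_hat x <= b 1, so that the truncated
   subtraction in the exponent is the true one. *)
Lemma rank_hat_le (r : nat) (b : nat -> nat) (x : ferrers_hat r b) :
  boundary r b -> (rank_hat x <= b 1%N)%N.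
Proof.
case=> bD _; case: x => //= -[[i c] /andP[/andP[/= i1 ir] /andP[/= ic cb]]] /=.
rewrite addn1 -subSn // leq_subLR -add1n leq_add //.
exact: leq_trans cb (bD 1%N i isT i1 ir).
Qed.

Definition char_poly_hat (r : nat) (b : nat -> nat) : {poly int} :=
  \sum_(x : ferrers_hat r b)
     moebius (\bot%O : ferrers_hat r b) x *: 'X^(b 1%N - rank_hat x).

Definition balanced (r i : nat) : nat := (2 * r - i)%N.

(** * Positive-root posets of types B and C *)

(* Roots are integer vectors, with the realisations and the simple roots of
   Bourbaki: e_1 - e_2, ..., e_(r-1) - e_r, followed by e_r in type B and by
   2 e_r in type C. Indices here start at 0. *)
Section RootPosets.
Variable r : nat.
Implicit Types (i j : 'I_r) (u v : 'rV[int]_r).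

Definition std_basis i : 'rV[int]_r := delta_mx ord0 i.

Definition simple_root (last : 'rV[int]_r) i : 'rV[int]_r :=
  if insub i.+1 is Some j then std_basis i - std_basis j else last.

Definition simple_root_B i : 'rV[int]_r := simple_root (std_basis i) i.
Definition simple_root_C i : 'rV[int]_r := simple_root (std_basis i *+ 2) i.

Definition positive_root_B v : Prop :=
  (exists i, v = std_basis i) \/
  (exists i j, (i < j)%N /\
     (v = std_basis i - std_basis j \/ v = std_basis i + std_basis j)).

Definition positive_root_C v : Prop :=
  (exists i, v = std_basis i *+ 2) \/
  (exists i j, (i < j)%N /\
     (v = std_basis i - std_basis j \/ v = std_basis i + std_basis j)).

Definition root_le (simple : 'I_r -> 'rV[int]_r) u v : Prop :=
  exists k : 'I_r -> nat, v - u = \sum_i simple i *+ k i.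

End RootPosets.

Definition poset_iso_on (d : Order.disp_t) (T : porderType d) (V : Type)
    (P : V -> Prop) (le : V -> V -> Prop) : Prop :=
  exists f : T -> V,
    [/\ injective f,
        forall v : V, P v <-> (exists x : T, f x = v)
      & forall x y : T, (x <= y)%O <-> le (f x) (f y)].

(* Main.v *)
Require Import Defs.
From HB Require Import structures.
From mathcomp Require Import all_boot all_order all_algebra.
From mathcomp Require Import zify ring.
Import Order.TTheory GRing.Theory Num.Theory.
Local Open Scope ring_scope.

(* The only cells with non-zero Moebius value are the r atoms (i, i), with value
   -1, and the r - 1 cells (i, i+1) with i < r, with value 1: these lie in the
   poset whatever b is, and any other cell (i, c) has n = min(c, r) - i + 1 cells
   of the first kind and n - 1 of the second kind below it, so that the
   recursion gives it the value -(1 - n + (n - 1)) = 0.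

   With 1-based indices, the cell (i, c) corresponds in type B to the root
   e_i - e_(c+1), e_i or e_i + e_(2r+1-c) according to c < r, c = r or c > r, and
   in type C to e_i - e_(c+1) if c < r and e_i + e_(2r-c) otherwise. The
   coefficients of a vector on the simple roots are its prefix sums (with the last
   one halved in type C), which turns the root order into inequalities between
   prefix sums. *)

(** * Sums over the augmented poset and over its cells *)

Lemma big_with_bot (V : nmodType) (T : finType) (P : pred (with_bot T))
    (F : with_bot T -> V) :
  \sum_(x | P x) F x =
  (if P None then F None else 0) + \sum_(x : T | P (Some x)) F (Some x).
Proof.
have e : perm_eq (index_enum (with_bot T)) (None :: map Some (index_enum T)).
  apply: uniq_perm; first exact: index_enum_uniq.
    rewrite /= map_inj_uniq ?index_enum_uniq ?andbT; last by move=> ? ? [].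
    by apply/mapP => -[].
  move=> [x|]; rewrite !(mem_index_enum, inE) //=.
  by apply/esym/mapP; exists x; rewrite // mem_index_enum.
rewrite (perm_big _ e) big_cons big_map.
by case: ifP; rewrite ?add0r.
Qed.

Lemma sum_ferrers (V : nmodType) (r : nat) (b : nat -> nat) (F : nat * nat -> V) :
  \sum_(x : ferrers r b) F x =
  \sum_(1 <= i < r.+1) \sum_(i <= c < (b i).+1) F (i, c).
Proof.
have e : perm_eq (index_enum (ferrers r b)) (ferrers_enum r b).
  have E x : (x \in ferrers_enum r b) = true.
    by rewrite -has_pred1 has_count ferrers_enumP.
  apply: uniq_perm; first exact: index_enum_uniq.
    by apply/count_mem_uniq => x; rewrite ferrers_enumP E.
  by move=> x; rewrite mem_index_enum E.
rewrite (perm_big _ e) -(big_map (@cell r b) xpredT).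
rewrite (pmap_filter (insubK (ferrers r b))) (all_filterP _); last first.
  apply/allP => _ /allpairsPdep[i [c [+ + ->]]].
  rewrite !mem_iota => /andP[i1 ir] /andP[ic cb].
  by rewrite isSome_insub /in_ferrers /=; lia.
by rewrite big_allpairs_dep /index_iota subSS subn0.
Qed.

(** Row i always contains (i, i), and for i < r it contains (i, i+1) because b_i >= b_(i+1) >= i+1.
    In the last row (r, r+1) may fail to be a cell, whence the condition that [F] vanishes there. *)
Lemma sum_near_diagonal (V : nmodType) (r : nat) (b : nat -> nat)
    (F : nat * nat -> V) : boundary r b ->
  (forall i c, (i.+1 < c)%N -> F (i, c) = 0) -> F (r, r.+1) = 0 ->
  \sum_(x : ferrers r b) F x =
  \sum_(1 <= i < r.+1) (F (i, i) + F (i, i.+1)).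
Proof.
move=> [bD bL] F0 Fr; rewrite sum_ferrers.
apply: eq_big_nat => i /andP[i1]; rewrite ltnS => ir.
rewrite big_ltn ?ltnS ?bL //; congr (_ + _).
have [bi|bi] := ltnP i (b i).
  rewrite big_ltn // big_nat big1 ?addr0 // => c /andP[ic _].
  exact: F0.
rewrite big_geq //.
have [ri|] := ltnP i r; last by move=> ri; rewrite (_ : i = r) ?Fr //; lia.
have := bL i.+1 isT ri; have := bD i i.+1 i1 (leqnSn _) ri; lia.
Qed.

(** * The Moebius function from the new minimum *)

(** Defined on all pairs, so that sums can be taken row by row; the bound [x.1 < r] gives 0 at (r,
    r+1), which may or may not be a cell. *)
Definition moebius_hat_cell (r : nat) (x : nat * nat) : int :=
  if x.2 == x.1 then -1 else if (x.2 == x.1.+1) && (x.1 < r)%N then 1 else 0.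

Lemma moebius_hatE (r : nat) (b : nat -> nat) (u : ferrers r b) : boundary r b ->
  moebius (\bot%O : ferrers_hat r b) (Some u) = moebius_hat_cell r u.
Proof.
move=> bP; have [n] := ubnP #|[pred v : ferrers r b | (v < u)%O]|.
elim: n => // n IH in u *; rewrite ltnS => un.
rewrite moebiusE /= big_with_bot.
rewrite [X in - (X + _)](_ : _ = 1); last by rewrite moebiusE eqxx.
have -> : \sum_(x : ferrers r b | (\bot%O <= (Some x : ferrers_hat r b) < Some u)%O)
    moebius (\bot%O : ferrers_hat r b) (Some x) =
    \sum_(x : ferrers r b)
      (if [&& u.1 <= x.1, x.2 <= u.2 & cell x != cell u]%N
       then moebius_hat_cell r x else 0).
  rewrite [LHS]big_mkcond; apply: eq_bigr => v _.
  have -> : (\bot%O <= (Some v : ferrers_hat r b) < Some u)%O = (v < u)%O.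
    by rewrite le0x /= !lt_neqAle.
  have -> : (v < u)%O = [&& u.1 <= v.1, v.2 <= u.2 & cell v != cell u]%N.
    by rewrite lt_neqAle andbC -andbA.
  case: ifP => // vu; apply: IH; apply: leq_trans un.
  have {}vu : (v < u)%O by rewrite lt_neqAle andbC -andbA.
  apply/proper_card/properP; split; last by exists v; rewrite !inE ?ltxx.
  by apply/subsetP => t; rewrite !inE => /lt_trans; apply.
set F := fun x : nat * nat => if [&& (u.1 <= x.1)%N, (x.2 <= u.2)%N & x != cell u]
  then moebius_hat_cell r x else 0.
have F0 i c : (i.+1 < c)%N -> F (i, c) = 0.
  by move=> ic; rewrite /F /moebius_hat_cell /=; do !case: ifP => //; lia.
have Fr : F (r, r.+1) = 0.
  by rewrite /F /moebius_hat_cell /=; do !case: ifP => //; lia.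
rewrite (sum_near_diagonal _ _ _ F) // {F0 Fr}/F.
case: u {IH un} => -[i0 c0] /= /andP[/= /andP[i1 ir] /andP[ic cb]].
(* An atom has no other cell below it, so only the new minimum contributes. *)
have [->|ne] := eqVneq c0 i0.
  rewrite big_nat big1 ?addr0 /moebius_hat_cell /= ?eqxx // => i _.
  by rewrite !xpair_eqE; case: ifP; case: ifP => //; lia.
(* The sum telescopes along g, up to a correction k at the row of u. *)
pose g i : int := if [&& i0 < i, i <= c0 & i <= r]%N then 1 else 0.
pose k : int := if (c0 == i0.+1) && (i0 < r)%N then 2 else 1.
rewrite (_ : \sum_(_ <= i < _) _ = \sum_(1 <= i < r.+1) (g i.+1 - g i)
    - \sum_(1 <= i < r.+1 | i == i0) k); last first.
  rewrite [X in _ - X]big_mkcond -sumrB; apply: eq_big_nat => i /andP[_ ir1].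
  rewrite /moebius_hat_cell /g /k /= !xpair_eqE eqxx /=.
  do !case: ifP; lia.
(* [g] vanishes at 1 and at r+1, so the cells contribute -k and the value is k - 1. Here k is 2
   exactly when the cell is itself of the form (i, i+1) with i < r, its own term being excluded from
   the sum. *)
rewrite telescope_sumr // big_nat1_eq /moebius_hat_cell /g /k /=; do !case: ifP; lia.
Qed.

(** * The characteristic polynomial *)

(** The r atoms have rank 1 and the r - 1 cells (i, i+1) with i < r have rank 2. For r = 1 the
    exponent [b 1 - 2] may be truncated, but its coefficient is 0. *)
Lemma char_poly_hatE (r : nat) (b : nat -> nat) : (1 <= r)%N -> boundary r b ->
  char_poly_hat r b =
  'X^(b 1%N) - r%:Z *: 'X^(b 1%N - 1) + (r%:Z - 1) *: 'X^(b 1%N - 2).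
Proof.
move=> r1 bP; rewrite /char_poly_hat big_with_bot /= moebiusE eqxx scale1r subn0.
rewrite -addrA; congr (_ + _).
pose F (x : nat * nat) : {poly int} :=
  moebius_hat_cell r x *: 'X^(b 1%N - (x.2 - x.1 + 1)).
transitivity (\sum_(x : ferrers r b) F x).
  by apply: eq_bigr => x _; rewrite moebius_hatE.
have F0 i c : (i.+1 < c)%N -> F (i, c) = 0.
  move=> ic; rewrite /F /moebius_hat_cell /= !ifF ?scale0r //; lia.
have Fr : F (r, r.+1) = 0.
  by rewrite /F /moebius_hat_cell /= !ifF ?scale0r //; lia.
rewrite (sum_near_diagonal _ _ _ F) // big_split [X in _ + X = _]big_nat_recr //=.
rewrite [X in _ + (_ + X) = _]Fr addr0.
congr (_ + _).
  under eq_bigr do rewrite /F /moebius_hat_cell /= eqxx subnn.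
  by rewrite big_const_nat iter_addr_0 subSS subn0 scaleN1r mulNrn -scaler_nat natz.
rewrite (eq_big_nat _ _ (F2 := fun=> 'X^(b 1%N - 2))); last first.
  move=> i /andP[_ ir]; rewrite /F /moebius_hat_cell /= ifF; last by lia.
  by rewrite eqxx ir scale1r subSnn.
rewrite big_const_nat iter_addr_0 -scaler_nat; congr (_ *: _); lia.
Qed.

Lemma char_poly_hat_balanced (r : nat) : (2 <= r)%N ->
  'X^(balanced r 1) - r%:Z *: 'X^(balanced r 1 - 1)
    + (r%:Z - 1) *: 'X^(balanced r 1 - 2) =
  'X^(2 * r - 3) * ('X - 1) * ('X - (r%:Z - 1)%:P) :> {poly int}.
Proof.
move=> r2; rewrite /balanced.
have -> : (2 * r - 1 = (2 * r - 3).+2)%N by lia.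
rewrite subSS subn0 subSS subn1 /= !exprS -!mul_polyC polyCB.
ring.
Qed.

Lemma boundary_balanced (r : nat) : boundary r (balanced r).
Proof. by split=> [i j|i]; rewrite /balanced; lia. Qed.

(** * The lattice property *)

Lemma ferrers_hat_leE (r : nat) (b : nat -> nat) (x y : ferrers r b) :
  ((Some x : ferrers_hat r b) <= Some y)%O = (y.1 <= x.1)%N && (x.2 <= y.2)%N.
Proof. by []. Qed.

(** The join of two cells takes the smaller row and the larger column, a cell because b is
    nonincreasing; the meet takes the larger row and the smaller column, or is the new minimum when
    that row exceeds that column. *)
Lemma ferrers_hat_lattice (r : nat) (b : nat -> nat) : boundary r b ->
  is_lattice (ferrers_hat r b).
Proof.
move=> [bD _] [x|] [y|]; first last.
- by split; exists None => -[].
- split; [exists None|exists (Some y)] => z; first by case: z.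
  by rewrite le0x.
- split; [exists None|exists (Some x)] => z; first by case: z => //= z; rewrite andbF.
  by rewrite le0x andbT.
case: x y => -[i c] xP [[j d] yP].
have := xP; have := yP; rewrite /in_ferrers /= => yP' xP'.
split; last first.
  have jP : in_ferrers r b (minn i j, maxn c d).
    have [ij|ji] := leqP i j.
      have := bD i j; rewrite /in_ferrers /=; lia.
    have := bD j i; rewrite /in_ferrers /=; lia.
  exists (Some (FerrersCell jP)) => -[[[k e] zP]|] //.
  rewrite !ferrers_hat_leE /=; lia.
have [h|h] := leqP (maxn i j) (minn c d).
  have mP : in_ferrers r b (maxn i j, minn c d).
    rewrite /in_ferrers /=; have [ij|ji] := leqP i j; lia.
  exists (Some (FerrersCell mP)) => -[[[k e] zP]|] //.
  rewrite !ferrers_hat_leE /=; lia.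
exists None => -[[[k e] zP]|] //.
transitivity false => //.
have := zP; rewrite !ferrers_hat_leE /in_ferrers /=; lia.
Qed.

(** * Prefix sums and the root order *)

(* Indices start at 0; the vector is 0 when [r <= k]. *)
Definition basis_vec (r k : nat) : 'rV[int]_r :=
  \row_j (if (j : nat) == k then 1 else 0).

Definition prefix_sum {r : nat} (m : nat) (v : 'rV[int]_r) : int :=
  \sum_(l < r | (l <= m)%N) v 0 l.

Section PrefixSums.
Variable r : nat.
Implicit Types (u v : 'rV[int]_r) (m k : nat).

Fact prefix_sum_is_zmod_morphism m : zmod_morphism (@prefix_sum r m).
Proof.
by move=> u v; rewrite /prefix_sum -sumrB; apply: eq_bigr => l _; rewrite !mxE.
Qed.

HB.instance Definition _ m :=
  GRing.isZmodMorphism.Build _ _ (@prefix_sum r m) (prefix_sum_is_zmod_morphism m).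

Lemma prefix_sum_basis m k :
  prefix_sum m (basis_vec r k) = if (k <= m)%N && (k < r)%N then 1 else 0.
Proof.
rewrite /prefix_sum (eq_bigr (fun l : 'I_r => if l == k :> nat then 1 else 0)).
  rewrite -big_mkcondr /=.
  by rewrite (big_ord1_cond_eq _ (fun=> 1) (fun l => (l <= m)%N)) andbC.
by move=> l _; rewrite mxE.
Qed.

(** Entry l is what the l-th prefix sum adds to the earlier entries, so the entries are recovered
    one after another. *)
Lemma prefix_sum_inj u v :
  (forall m : 'I_r, prefix_sum m u = prefix_sum m v) -> u = v.
Proof.
move=> uv; apply/rowP => -[l].
elim/ltn_ind: l => l IH lr; have := uv (Ordinal lr).
rewrite /prefix_sum !(bigD1 (P := fun _ => (_ <= _)%N) (Ordinal lr)) //=.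
rewrite (eq_bigr (fun i => v 0 i)); first by move/addIr.
move=> [i ir] /= /andP[il]; rewrite -val_eqE /= => ne.
by apply: IH; rewrite ltn_neqAle ne.
Qed.

Lemma std_basisE (i : 'I_r) : std_basis i = basis_vec r i.
Proof.
by apply/rowP => j; rewrite !mxE eqxx /= -val_eqE; case: ifP.
Qed.

Lemma basis_vec_size : basis_vec r r = 0.
Proof. by apply/rowP => j; rewrite !mxE ifF //; have := ltn_ord j; lia. Qed.

(* [d] is 1 except for the last simple root 2 e_r of type C, where it is 2. *)
Lemma root_leP (simple : 'I_r -> 'rV[int]_r) (d : 'I_r -> nat) u v :
  (forall i m : 'I_r, prefix_sum m (simple i) = if i == m then (d i)%:Z else 0) ->
  root_le simple u v <->
  (forall m : 'I_r, exists k : nat, prefix_sum m (v - u) = (k * d m)%N).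
Proof.
move=> sE.
(* Each prefix sum sees a single simple root, so it reads off one coefficient. *)
have sumE (k : 'I_r -> nat) (m : 'I_r) :
    prefix_sum m (\sum_i simple i *+ k i) = (k m * d m)%N :> int.
  rewrite raddf_sum (bigD1 m) //= big1 ?addr0 => [|i /negbTE im].
    by rewrite raddfMn /= sE eqxx; lia.
  by rewrite raddfMn /= sE im mul0rn.
split=> [[k ->] m|]; first by exists (k m).
move/fin_all_exists => [k kE]; exists k.
by apply: prefix_sum_inj => m; rewrite sumE.
Qed.

(** Past index i the second term of e_i - e_(i+1) cancels the first; the last root has no later
    index. *)
Lemma prefix_sum_simple_B (i m : 'I_r) :
  prefix_sum m (simple_root_B i) = if i == m then 1 else 0.
Proof.
have mr := ltn_ord m; have ir := ltn_ord i.
rewrite /simple_root_B /simple_root -val_eqE /=.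
case: insubP => [j _ /= jE|ijr]; rewrite ?raddfB /= !std_basisE !prefix_sum_basis;
  do !case: ifP; lia.
Qed.

Lemma prefix_sum_simple_C (i m : 'I_r) :
  prefix_sum m (simple_root_C i) =
  if i == m then (if i.+1 == r then 2 else 1)%N%:Z else 0.
Proof.
have mr := ltn_ord m; have ir := ltn_ord i.
rewrite /simple_root_C /simple_root -val_eqE /=.
case: insubP => [j jr /= jE|ijr];
  rewrite ?raddfB ?mulr2n ?raddfD /= !std_basisE !prefix_sum_basis;
  do !case: ifP; lia.
Qed.

(** * Cells as positive roots of types B and C *)

(** Injectivity follows from the order equivalence: two cells with the same image lie below each
    other. *)
Lemma poset_iso_root_le (b : nat -> nat) (simple : 'I_r -> 'rV[int]_r)
    (P : 'rV[int]_r -> Prop) (f : nat * nat -> 'rV[int]_r) :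
  (forall v, P v <-> exists2 x, in_ferrers r b x & f x = v) ->
  (forall x y, in_ferrers r b x -> in_ferrers r b y ->
     (y.1 <= x.1)%N && (x.2 <= y.2)%N <-> root_le simple (f x) (f y)) ->
  poset_iso_on (ferrers r b) P (root_le simple).
Proof.
move=> fP fle; exists (fun x => f (cell x)).
have le_f (x y : ferrers r b) : (x <= y)%O <-> root_le simple (f x) (f y).
  by apply: fle; apply: cellP.
split=> // [x y fxy|v].
  have refl u : root_le simple u u.
    by exists (fun=> 0%N); rewrite subrr big1.
  by apply/le_anti/andP; split; apply/le_f; rewrite fxy.
rewrite fP; split=> [[x xP <-]|[x <-]]; first by exists (FerrersCell xP).
by exists (cell x) => //; apply: cellP.
Qed.

(** The 0-based index [x.2] stands for e_(c+1), which vanishes at c = r; this gives the short root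
    e_i. *)
Definition cell_root_B (x : nat * nat) : 'rV[int]_r :=
  basis_vec r x.1.-1 +
  (if (x.2 <= r)%N then - basis_vec r x.2 else basis_vec r (2 * r - x.2)).

(** The long root 2 e_i arises at the end c = 2r - i of row i, where the two indices agree. *)
Definition cell_root_C (x : nat * nat) : 'rV[int]_r :=
  basis_vec r x.1.-1 +
  (if (x.2 < r)%N then - basis_vec r x.2 else basis_vec r (2 * r - x.2).-1).

Lemma positive_root_B_cell v :
  positive_root_B v <->
  exists2 x, in_ferrers r (balanced r) x & cell_root_B x = v.
Proof.
rewrite /in_ferrers /cell_root_B /balanced; split.
  case=> [[i ->]|[i [j [ij [->|->]]]]]; rewrite !std_basisE.
  - have := ltn_ord i; exists (i.+1, r); rewrite /=; first lia.
    by rewrite leqnn basis_vec_size subr0.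
  - have := ltn_ord j; exists (i.+1, j : nat); rewrite /=; first lia.
    by rewrite ifT //; lia.
  - have := ltn_ord j; exists (i.+1, (2 * r - j)%N); rewrite /=; first lia.
    rewrite ifF; last by lia.
    by congr (_ + basis_vec _ _); lia.
case=> -[i c] /= ic <-.
have ir : (i.-1 < r)%N by lia.
case: (ltngtP c r) => cr.
- right; exists (Ordinal ir), (Ordinal cr); rewrite /= !std_basisE /=.
  by split; [lia|left].
- have jr : (2 * r - c < r)%N by lia.
  right; exists (Ordinal ir), (Ordinal jr); rewrite /= !std_basisE /=.
  by split; [lia|right].
by left; exists (Ordinal ir); rewrite std_basisE cr basis_vec_size subr0.
Qed.

Lemma positive_root_C_cell v :
  positive_root_C v <->
  exists2 x, in_ferrers r (balanced r) x & cell_root_C x = v.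
Proof.
rewrite /in_ferrers /cell_root_C /balanced; split.
  case=> [[i ->]|[i [j [ij [->|->]]]]]; rewrite !std_basisE.
  - have := ltn_ord i; exists (i.+1, (2 * r - i.+1)%N); rewrite /=; first lia.
    rewrite ifF; last by lia.
    by rewrite mulr2n; congr (_ + basis_vec _ _); lia.
  - have := ltn_ord j; exists (i.+1, j : nat); rewrite /=; first lia.
    by rewrite ifT //; lia.
  - have := ltn_ord j; exists (i.+1, (2 * r - j.+1)%N); rewrite /=; first lia.
    rewrite ifF; last by lia.
    by congr (_ + basis_vec _ _); lia.
case=> -[i c] /= ic <-.
have ir : (i.-1 < r)%N by lia.
have [cr|rc] := ltnP c r.
  right; exists (Ordinal ir), (Ordinal cr); rewrite /= !std_basisE /=.
  by split; [lia|left].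
have jr : ((2 * r - c).-1 < r)%N by lia.
have [ij|ij] := eqVneq i.-1 (2 * r - c).-1.
  by left; exists (Ordinal ir); rewrite std_basisE mulr2n /= -ij.
right; exists (Ordinal ir), (Ordinal jr); rewrite /= !std_basisE /=.
by split; [lia|right].
Qed.

(** Since m < r, the bounds on [x.2] already tell whether the second basis vector is subtracted or
    added. *)
Lemma prefix_sum_cell_B (x : nat * nat) (m : 'I_r) :
  in_ferrers r (balanced r) x ->
  prefix_sum m (cell_root_B x) =
  (if (x.1 <= m.+1)%N then 1 else 0) +
  (if (x.2 <= m)%N then -1 else if (2 * r <= m + x.2)%N then 1 else 0).
Proof.
rewrite /in_ferrers /balanced => xP; have := ltn_ord m.
rewrite /cell_root_B raddfD /= prefix_sum_basis.
case: (leqP x.2 r) => cr mr; rewrite ?raddfN /= prefix_sum_basis; do !case: ifP; lia.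
Qed.

Lemma prefix_sum_cell_C (x : nat * nat) (m : 'I_r) :
  in_ferrers r (balanced r) x ->
  prefix_sum m (cell_root_C x) =
  (if (x.1 <= m.+1)%N then 1 else 0) +
  (if (x.2 <= m)%N then -1 else if (2 * r <= (m + x.2).+1)%N then 1 else 0).
Proof.
rewrite /in_ferrers /balanced => xP; have := ltn_ord m.
rewrite /cell_root_C raddfD /= prefix_sum_basis.
case: (ltnP x.2 r) => cr mr; rewrite ?raddfN /= prefix_sum_basis; do !case: ifP; lia.
Qed.

Lemma cell_root_B_le (x y : nat * nat) :
  in_ferrers r (balanced r) x -> in_ferrers r (balanced r) y ->
  (y.1 <= x.1)%N && (x.2 <= y.2)%N <->
  root_le (@simple_root_B r) (cell_root_B x) (cell_root_B y).
Proof.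
move=> xP yP; rewrite (root_leP _ (fun=> 1%N)); last first.
  by move=> i m; rewrite prefix_sum_simple_B.
have dE (m : 'I_r) : prefix_sum m (cell_root_B y - cell_root_B x) =
    prefix_sum m (cell_root_B y) - prefix_sum m (cell_root_B x) by rewrite raddfB.
split=> [xy m|le].
  rewrite dE !prefix_sum_cell_B //.
  (* Neither lowering the row nor raising the column decreases a prefix sum, so [z] is
     nonnegative. *)
  set z := (X in exists k, X = _); exists `|z|%N.
  rewrite muln1 gez0_abs // /z; do !case: ifP; lia.
move: xP yP (xP) (yP) => xF yF; rewrite /in_ferrers /balanced => xP yP.
have ir : (x.1.-1 < r)%N by lia.
(* Index [x.1.-1] is the first where the prefix sum of [x] is positive; that of [y] is positive
   there only if its row is no larger. *)
have yx : (y.1 <= x.1)%N.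
  case: (le (Ordinal ir)) => k; rewrite dE !prefix_sum_cell_B //=; do !case: ifP; lia.
(* If [x.2 <= r], a smaller column of [y] would make its prefix sum 0 at index [x.2.-1], where that
   of [x] is 1. Otherwise the prefix sum of [x] reaches 2 at index [2 * r - x.2]. *)
rewrite yx /=; have [cr|rc] := leqP x.2 r.
  have cr' : (x.2.-1 < r)%N by lia.
  case: (le (Ordinal cr')) => k; rewrite dE !prefix_sum_cell_B //=; do !case: ifP; lia.
have cr' : (2 * r - x.2 < r)%N by lia.
case: (le (Ordinal cr')) => k; rewrite dE !prefix_sum_cell_B //=; do !case: ifP; lia.
Qed.

Lemma cell_root_C_le (x y : nat * nat) :
  in_ferrers r (balanced r) x -> in_ferrers r (balanced r) y ->
  (y.1 <= x.1)%N && (x.2 <= y.2)%N <->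
  root_le (@simple_root_C r) (cell_root_C x) (cell_root_C y).
Proof.
move=> xP yP.
rewrite (root_leP _ (fun i : 'I_r => if i.+1 == r then 2 else 1)%N); last first.
  exact: prefix_sum_simple_C.
have dE (m : 'I_r) : prefix_sum m (cell_root_C y - cell_root_C x) =
    prefix_sum m (cell_root_C y) - prefix_sum m (cell_root_C x) by rewrite raddfB.
move: xP yP (xP) (yP) => xF yF; rewrite /in_ferrers /balanced => xP yP.
split=> [xy m|le].
  have mr := ltn_ord m.
  rewrite dE !prefix_sum_cell_C //.
  set z := (X in exists k, X = _).
  (* At the last index the prefix sums are 0 or 2, and the coefficient of 2 e_r is half of their
     difference [z]. *)
  exists (if m.+1 == r then if z == 0 then 0 else 1 else `|z|)%N.
  rewrite /z; do !case: ifP; lia.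
have ir : (x.1.-1 < r)%N by lia.
have yx : (y.1 <= x.1)%N.
  case: (le (Ordinal ir)) => k; rewrite dE !prefix_sum_cell_C //=; do !case: ifP; lia.
rewrite yx /=; have [cr|rc] := leqP x.2 r.
  have cr' : (x.2.-1 < r)%N by lia.
  case: (le (Ordinal cr')) => k; rewrite dE !prefix_sum_cell_C //=; do !case: ifP; lia.
(* The prefix sum of [x] reaches 2 one index earlier than in type B. *)
have cr' : ((2 * r - x.2).-1 < r)%N by lia.
case: (le (Ordinal cr')) => k; rewrite dE !prefix_sum_cell_C //=; do !case: ifP; lia.
Qed.
End PrefixSums.

Theorem corollary5p4 (r : nat) (r_ge1 : (1 <= r)%N) :
  [/\ (* the characteristic polynomial; the last coefficient is 0 if r = 1 *)
      forall b : nat -> nat, boundary r b ->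
        char_poly_hat r b =
          'X^(b 1%N) - r%:Z *: 'X^(b 1%N - 1) + (r%:Z - 1) *: 'X^(b 1%N - 2),
      (* it does not depend on b_2, ..., b_r *)
      forall b b' : nat -> nat, boundary r b -> boundary r b' ->
        b 1%N = b' 1%N -> char_poly_hat r b = char_poly_hat r b'
    & (* the balanced boundary *)
      (2 <= r)%N ->
        [/\ is_lattice (ferrers_hat r (balanced r)),
            poset_iso_on (ferrers r (balanced r))
              (@positive_root_B r) (root_le (@simple_root_B r)),
            poset_iso_on (ferrers r (balanced r))
              (@positive_root_C r) (root_le (@simple_root_C r))
          & char_poly_hat r (balanced r) =
              'X^(2 * r - 3) * ('X - 1) * ('X - (r%:Z - 1)%:P)]].
Proof.
have E b : boundary r b -> char_poly_hat r b =
    'X^(b 1%N) - r%:Z *: 'X^(b 1%N - 1) + (r%:Z - 1) *: 'X^(b 1%N - 2).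
  exact: char_poly_hatE.
split=> // [b b' bP b'P b1|r2]; first by rewrite !E // b1.
split.
- exact/ferrers_hat_lattice/boundary_balanced.
- exact: poset_iso_root_le (@positive_root_B_cell r) (@cell_root_B_le r).
- exact: poset_iso_root_le (@positive_root_C_cell r) (@cell_root_C_le r).
- by rewrite E ?char_poly_hat_balanced //; apply: boundary_balanced.
Qed.
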